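(* Let $0\le\alpha<1$ and let $\mathcal{K}$ be the $n\times n$ first-order stable spline kernel, $\mathcal{K}_{ij}=\alpha^{\max(i,j)}$ for $1\le i,j\le n$. Consider the maximum entropy band extension problem with bandwidth $m=1$ and specified entries $\sigma_{ij}=\mathcal{K}_{ij}=\alpha^{\max(i,j)}$ for $|i-j|\le 1$, i.e. consider the partially specified $1$-band symmetric $n\times n$ matrix $\Sigma_n^{(1)}(x)$ with entries $$[\Sigma_n^{(1)}(x)]_{ij}=\alpha^{\max(i,j)}\ \text{ if } |i-j|\le 1,\qquad [\Sigma_n^{(1)}(x)]_{ij}=[\Sigma_n^{(1)}(x)]_{ji}=x_{ij}\ \text{ if } j-i>1,$$ and the problem $$\text{minimize over } x\quad -\log\det\Sigma_n^{(1)}(x)\quad\text{subject to}\quad \Sigma_n^{(1)}(x)\succeq 0 .$$ Let $x^o$ denote its optimal solution. Then $\Sigma_n^{(1)}(x^o)=\mathcal{K}$, i.e. the solution of the maximum entropy problem coincides with the first-order stable spline kernel.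
   Context: $\Sigma\succeq 0$ means that the symmetric matrix $\Sigma$ is positive semidefinite. The vector $x$ collects the unspecified real entries $x_{ij}$, $|i-j|>1$, which are the optimization variables; the entries with $|i-j|\le 1$ are prescribed. By convention $-\log\det\Sigma=+\infty$ when $\Sigma$ is singular. The problem is called a maximum entropy problem because the differential entropy of a zero-mean Gaussian distribution on $\mathbb{R}^n$ with covariance $\Sigma$ is $\tfrac12\log\det\Sigma+\tfrac n2(1+\log 2\pi)$. *)

(* Defs.v *)
(* Matrices are indexed by 'I_n, that is from 0: the ordinal i stands for the
   1-based index i.+1.  Band membership depends only on differences of indices;
   the shift is explicit in the kernel. *)
From mathcomp Require Import all_boot all_order all_algebra.
From mathcomp Require Import all_classical all_reals all_analysis.

Set Implicit Arguments.
Unset Strict Implicit.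
Unset Printing Implicit Defensive.

Import Order.TTheory GRing.Theory Num.Theory.
Local Open Scope ring_scope.

Definition psdmx (R : realType) (n : nat) (A : 'M[R]_n) : Prop :=
  A \is symmetricmx /\ forall v : 'cV[R]_n, 0 <= (v^T *m A *m v) 0 0.

Definition stable_spline_kernel (R : realType) (n : nat) (alpha : R) : 'M[R]_n :=
  \matrix_(i, j) alpha ^+ maxn i.+1 j.+1.

(* The pairs (i, j) with j - i > m.  The subtraction is truncated, so this
   forces i < j. *)
Definition off_band (m n : nat) : finType :=
  {p : 'I_n * 'I_n | (m < p.2 - p.1)%N}.

(* The symmetric matrix that agrees with sigma where |i - j| <= m (the last
   branch; the other entries of sigma are not read) and has the free entries x
   above the band, mirrored below it. *)
Definition band_extension (R : realType) (m n : nat) (sigma : 'M[R]_n)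
    (x : {ffun off_band m n -> R}) : 'M[R]_n :=
  \matrix_(i, j)
    if insub (i, j) is Some p then x p
    else if insub (j, i) is Some p then x p
    else sigma i j.

(* lne 0 = -oo, so this is +oo on singular matrices. *)
Definition neg_logdet (R : realType) (n : nat) (A : 'M[R]_n) : \bar R :=
  (- lne (\det A)%:E)%E.

Definition max_entropy_solution (R : realType) (m n : nat) (sigma : 'M[R]_n)
    (x : {ffun off_band m n -> R}) : Prop :=
  psdmx (band_extension sigma x) /\
  forall y : {ffun off_band m n -> R}, psdmx (band_extension sigma y) ->
    (neg_logdet (band_extension sigma x) <= neg_logdet (band_extension sigma y))%E.

(* Main.v *)
(* Successive differences, L := 1 - (superdiagonal shift), diagonalise the
   kernel: L K L^T = diag(alpha^i - alpha^(i+1), ..., alpha^n).  The diagonal of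
   L A L^T involves only the entries of A with |i - j| <= 1, so it is the same
   for every feasible A.  As det L = 1, Hadamard's inequality with its equality
   case, applied to L A L^T, shows that K is the only feasible matrix with
   determinant at least det K.  When alpha = 0 determinants say nothing, but then
   L A L^T is positive semidefinite with zero diagonal, so K is the only
   feasible matrix. *)
Require Import Defs.
From mathcomp Require Import all_boot all_order all_algebra.
From mathcomp Require Import all_classical all_reals all_analysis.
From mathcomp Require Import zify ring lra.

Import Order.TTheory GRing.Theory Num.Theory.
Local Open Scope ring_scope.

(** * Positive semidefinite matrices and equality in Hadamard's inequality *)

Section PositiveSemidefinite.
Variable R : realType.

Lemma symmetricmxP (n : nat) (A : 'M[R]_n) : A \is symmetricmx <-> A^T = A.
Proof.
split=> [/is_hermitianmxP|AT]; last apply/is_hermitianmxP.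
  by rewrite expr0 scale1r => {2}->; rewrite map_mx_id.
by rewrite expr0 scale1r map_mx_id.
Qed.

Lemma psdmx_congr (m n : nat) (P : 'M[R]_(m, n)) (A : 'M[R]_n) :
  psdmx A -> psdmx (P *m A *m P^T).
Proof.
move=> [/symmetricmxP AT Apos]; split.
  by apply/symmetricmxP; rewrite !trmx_mul trmxK AT mulmxA.
by move=> v; have := Apos (P^T *m v); rewrite trmx_mul trmxK !mulmxA.
Qed.

Lemma psdmx_sym (n : nat) (A : 'M[R]_n) i j : psdmx A -> A j i = A i j.
Proof. by move=> [/symmetricmxP AT _]; rewrite -{1}AT mxE. Qed.

Lemma psdmx_diag_mx (n : nat) (d : 'rV[R]_n) :
  (forall i, 0 <= d 0 i) -> psdmx (diag_mx d).
Proof.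
move=> d_ge0; split; first by apply/symmetricmxP; rewrite tr_diag_mx.
move=> v; rewrite mul_mx_diag mxE; apply: sumr_ge0 => i _; rewrite !mxE.
by rewrite mulrAC -expr2 mulr_ge0 ?sqr_ge0.
Qed.

Lemma delta_mx_form (n : nat) (A : 'M[R]_n) i j :
  (delta_mx (0 : 'I_1) i *m A *m delta_mx j (0 : 'I_1)) 0 0 = A i j.
Proof. by rewrite -rowE -colE !mxE. Qed.

(** Comes from evaluating the quadratic form at [s e_i + t e_j], where [i = j] is allowed. *)
Lemma psdmx_pair (n : nat) (A : 'M[R]_n) i j (s t : R) : psdmx A ->
  0 <= s ^+ 2 * A i i + 2 * s * t * A i j + t ^+ 2 * A j j.
Proof.
move=> A_psd; have [_ /(_ (s *: delta_mx i 0 + t *: delta_mx j 0))] := A_psd.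
have mxD (X Y : 'M[R]_1) : (X + Y) 0 0 = X 0 0 + Y 0 0 by rewrite mxE.
have mxZ (c : R) (X : 'M[R]_1) : (c *: X) 0 0 = c * X 0 0 by rewrite mxE.
rewrite [(_ + _)^T]linearD /= ![(_ *: _)^T]linearZ /= !trmx_delta.
rewrite !(mulmxDl, mulmxDr) -!(scalemxAl, scalemxAr).
rewrite !(mxD, mxZ) !delta_mx_form.
by rewrite (psdmx_sym _ _ i j A_psd); congr (_ <= _); ring.
Qed.

Lemma psdmx_diag_ge0 (n : nat) (A : 'M[R]_n) i : psdmx A -> 0 <= A i i.
Proof. by move=> /(psdmx_pair _ _ i i 1 0); rewrite !expr2; lra. Qed.

(** Along [s e_i + e_j] the form is affine in [s] with slope [2 * A i j], so it can stay nonnegative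
    only if the slope vanishes. *)
Lemma psdmx_diag_eq0 (n : nat) (A : 'M[R]_n) i j :
  psdmx A -> A i i = 0 -> A i j = 0.
Proof.
move=> A_psd Aii; apply/eqP; apply: contraT => Aij.
(* This coefficient is chosen to give the form the value [-1]. *)
have := psdmx_pair _ _ i j (- (A j j + 1) / (2 * A i j)) 1 A_psd.
rewrite Aii mulr0 add0r mulr1 expr1n mul1r.
have -> : 2 * (- (A j j + 1) / (2 * A i j)) * A i j = - (A j j + 1) by field.
lra.
Qed.

(** A zero diagonal entry would make its whole row vanish, and with it the determinant. *)
Lemma psdmx_det_diag_gt0 (n : nat) (A : 'M[R]_n) i :
  psdmx A -> \det A != 0 -> 0 < A i i.
Proof.
move=> A_psd; rewrite lt_neqAle psdmx_diag_ge0 // andbT eq_sym.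
apply: contraNneq => Aii; rewrite (expand_det_row A i) big1 // => j _.
by rewrite (psdmx_diag_eq0 _ _ _ j A_psd) ?mul0r.
Qed.

(** A strict inequality at one index would survive multiplication by the remaining factors, since
    they are positive. *)
Lemma eq_prod_le (I : finType) (f g : I -> R) :
  (forall i, 0 < f i <= g i) -> \prod_i g i <= \prod_i f i -> f =1 g.
Proof.
move=> fg le_prod i; have /andP[fi_gt0 le_fgi] := fg i.
apply/eqP; apply: contraLR le_prod => neq_fg.
rewrite -ltNge (bigD1 i) //= [X in _ < X](bigD1 i) //=.
have lt_fg : f i < g i by rewrite lt_neqAle neq_fg.
have f'_gt0 : 0 < \prod_(j | j != i) f j.
  by apply: prodr_gt0 => j _; case/andP: (fg j).
apply: lt_le_trans (_ : g i * \prod_(j | j != i) f j <= _).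
  by rewrite ltr_pM2r.
rewrite ler_wpM2l ?(le_trans (ltW fi_gt0)) //.
by apply: ler_prod => j _; case/andP: (fg j) => /ltW -> ->.
Qed.

(* The equality case of Hadamard's inequality, by induction on the dimension:
   the Schur complement S of the first entry satisfies the same hypotheses,
   because its diagonal is at most that of the block it comes from. *)
Lemma hadamard_rigidity (n : nat) (B : 'M[R]_n) :
  psdmx B -> 0 < \det B -> \prod_i B i i <= \det B -> is_diag_mx B.
Proof.
elim: n B => [|n IH] B B_psd detB_gt0 prod_le.
  by apply/is_diag_mxP => -[].
have a_gt0 : 0 < B 0 0 by apply: psdmx_det_diag_gt0; rewrite ?gt_eqF.
pose B' : 'M[R]_(1 + n) := B.
pose a := B 0 0; pose b := ursubmx B'; pose C := drsubmx B'.
have BE : B' = block_mx a%:M b b^T C.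
  rewrite -[LHS]submxK; congr block_mx.
    by apply/matrixP => i j; rewrite !ord1 !mxE !lshift0.
  by apply/matrixP => i j; rewrite !mxE; apply: psdmx_sym.
pose S := C - a^-1 *: (b^T *m b).
(* Block elimination: the unit lower triangular [P] clears the first column below [a], and
   congruence by it keeps the determinant and semidefiniteness. *)
pose P : 'M[R]_(1 + n) := block_mx 1%:M 0 (- a^-1 *: b^T) 1%:M.
have PBP : P *m B' *m P^T = block_mx a%:M 0 0 S.
  rewrite BE tr_block_mx !trmx1 trmx0 linearZ /= trmxK !mulmx_block.
  rewrite !(mul1mx, mulmx1, mul0mx, mulmx0, addr0, add0r).
  rewrite mul_mx_scalar mul_scalar_mx !scalerA mulrN divff ?gt_eqF //.
  by rewrite !scaleN1r !addNr mul0mx add0r scaleNr mulNmx -scalemxAl addrC.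
have detE : \det B = a * \det S.
  have := congr1 determinant PBP; rewrite det_lblock !det_mulmx det_tr.
  by rewrite det_lblock !det1 !mul1r mulr1 det_scalar expr1.
have S_psd : psdmx S.
  have := psdmx_congr _ _ (row_mx 0 1%:M) _ (psdmx_congr _ _ P _ B_psd).
  rewrite PBP tr_row_mx trmx0 trmx1 mul_row_block.
  by rewrite !(mul0mx, mulmx0, add0r, mul1mx) mul_row_col mulmx1 mulmx0 add0r.
have detS_gt0 : 0 < \det S by rewrite -(pmulr_rgt0 _ a_gt0) -detE.
have SE i : S i i = C i i - a^-1 * b 0 i ^+ 2.
  by rewrite !mxE big_ord_recl big_ord0 addr0 !mxE expr2.
have S_le i : 0 < S i i <= C i i.
  rewrite psdmx_det_diag_gt0 ?gt_eqF //= SE gerBl mulr_ge0 ?sqr_ge0 //.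
  by rewrite invr_ge0 ltW.
(* The factor [a = B 0 0] cancels from both sides of [prod_le]. *)
have prodC_le : \prod_i C i i <= \det S.
  rewrite -(ler_pM2l a_gt0) -detE; apply: le_trans prod_le.
  rewrite big_ord_recl ler_pM2l // le_eqVlt; apply/orP; left; apply/eqP.
  by apply: eq_bigr => i _; rewrite !mxE !rshift1.
have prodS_le : \prod_i S i i <= \prod_i C i i.
  by apply: ler_prod => i _; case/andP: (S_le i) => /ltW -> ->.
have S_diag : is_diag_mx S by apply: IH => //; apply: le_trans prodC_le.
(* Since [S] is diagonal, [\det S] is the product of its diagonal, so [prodC_le] forces
   [S i i = C i i]; the subtracted term [a^-1 * b 0 i ^+ 2] is then zero. *)
have b0 : b = 0.
  apply/rowP => i; rewrite [RHS]mxE.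
  have := eq_prod_le _ (fun i => S i i) (fun i => C i i) S_le.
  rewrite -(det_trig (is_diag_mx_is_trig S_diag)) => /(_ prodC_le i) /eqP.
  rewrite SE -subr_eq0 addrAC subrr add0r oppr_eq0 mulf_eq0 invr_eq0.
  by rewrite gt_eqF //= sqrf_eq0 => /eqP.
change (is_diag_mx B'); rewrite BE.
rewrite is_diag_block_mx // b0 trmx0 !eqxx /= scalar_mx_is_diag /=.
by move: S_diag; rewrite /S b0 mulmx0 scaler0 subr0.
Qed.

End PositiveSemidefinite.

(** * The matrix of successive differences *)

Section StableSpline.
Variable R : realType.

Definition difference_mx (n : nat) : 'M[R]_n :=
  \matrix_(i, j) ((i == j)%:R - (j == i.+1 :> nat)%:R).

Lemma det_difference_mx (n : nat) : \det (difference_mx n) = 1.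
Proof.
rewrite -det_tr det_trig.
  by apply: big1 => i _; rewrite !mxE eqxx ltn_eqF // subr0.
apply/is_trig_mxP => i j lt_ij; rewrite !mxE.
by rewrite -val_eqE /= gtn_eqF // ltn_eqF ?subrr // ltnW.
Qed.

Lemma difference_mx_neq0 (n : nat) (i k : 'I_n) :
  difference_mx n i k != 0 -> (k = i :> nat) \/ (k = i.+1 :> nat).
Proof.
rewrite mxE; have [-> | _] := eqVneq i k; first by left.
by case: (nat_of_ord k =P i.+1) => [|_]; [right | rewrite subrr eqxx].
Qed.

(** The last row has no superdiagonal entry; [g n = 0] lets it obey the same formula as the
    others. *)
Lemma sum_difference_mx (n : nat) (g : nat -> R) (i : 'I_n) :
  g n = 0 -> \sum_(j < n) difference_mx n i j * g j = g i - g i.+1.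
Proof.
move=> gn0; under eq_bigr do rewrite mxE mulrBl.
rewrite sumrB (bigD1 i) //= eqxx mul1r big1 ?addr0; last first.
  by move=> j /negbTE; rewrite eq_sym => ->; rewrite mul0r.
congr (_ - _); have [lt_in | le_ni] := ltnP i.+1 n.
  rewrite (bigD1 (Ordinal lt_in)) //= eqxx mul1r big1 ?addr0 // => j.
  by rewrite -val_eqE /= => /negbTE ->; rewrite mul0r.
have -> : i.+1 = n by apply/eqP; rewrite eqn_leq le_ni andbT ltn_ord.
by rewrite gn0 big1 // => j _; rewrite ltn_eqF // mul0r.
Qed.

(** * Diagonalisation and rigidity of the spline kernel *)

Section Kernel.
Variables (n : nat) (alpha : R).
Hypotheses (alpha_ge0 : 0 <= alpha) (alpha_lt1 : alpha < 1).

Let K : 'M[R]_n := stable_spline_kernel n alpha.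
Let L : 'M[R]_n := difference_mx n.

Definition spline_increments : 'rV[R]_n :=
  \row_i (alpha ^+ i.+1 - (if (i.+1 < n)%N then alpha ^+ i.+2 else 0)).
Let d := spline_increments.

Lemma spline_increments_ge0 i : 0 <= d 0 i.
Proof.
rewrite mxE; case: ifP => _; rewrite ?subr0 ?exprn_ge0 // subr_ge0.
by rewrite ler_wiXn2l // ltW.
Qed.

Lemma spline_increments_gt0 i : 0 < alpha -> 0 < d 0 i.
Proof.
move=> alpha_gt0; rewrite mxE; case: ifP => _; rewrite ?subr0 ?exprn_gt0 //.
by rewrite subr_gt0 ltr_iXn2l.
Qed.

Lemma difference_spline : L *m K *m L^T = diag_mx d.
Proof.
(* Extending the kernel by zero past the last index lets [sum_difference_mx] treat the last row and
   column uniformly. *)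
pose k i j := if (i < n)%N && (j < n)%N then alpha ^+ maxn i.+1 j.+1 else 0.
have kn0 i : k i n = 0 by rewrite /k ltnn andbF.
have k0n i : k n i = 0 by rewrite /k ltnn.
have LKE (i j : 'I_n) : (L *m K) i j = k i j - k i.+1 j.
  rewrite mxE -(sum_difference_mx n (k^~ j)) //.
  by apply: eq_bigr => l _; rewrite [K _ _]mxE /k !ltn_ord.
apply/matrixP => i j; rewrite mxE.
transitivity ((k i j - k i.+1 j) - (k i j.+1 - k i.+1 j.+1)).
  rewrite -(sum_difference_mx n (fun l => k i l - k i.+1 l)) ?kn0 ?subrr //.
  by apply: eq_bigr => l _; rewrite LKE [L^T _ _]mxE mulrC.
rewrite [RHS]mxE [d _ _]mxE /k !ltn_ord /= andbT.
have [<- | neq_ij] := eqVneq i j.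
  rewrite maxnn (maxn_idPl _) // (maxn_idPr _) // maxnn andbb.
  by case: ifP => _; rewrite mulr1n; ring.
(* For [i < j] the maximum does not change from [i] to [i.+1], so differencing in the row index
   gives zero; for [j < i] the column index plays that part. *)
case/boolP: (i < j)%N => lt_ij.
  have -> : (i.+1 < n)%N by have := ltn_ord j; lia.
  have -> : maxn i.+1 j.+1 = j.+1 by lia.
  have -> : maxn i.+2 j.+1 = j.+1 by lia.
  have -> : maxn i.+1 j.+2 = j.+2 by lia.
  have -> : maxn i.+2 j.+2 = j.+2 by lia.
  by rewrite mulr0n /=; case: ifP => _; ring.
have {}lt_ij : (j < i)%N by move: neq_ij; rewrite -val_eqE /=; lia.
have -> : (j.+1 < n)%N by have := ltn_ord i; lia.
have -> : maxn i.+1 j.+1 = i.+1 by lia.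
have -> : maxn i.+2 j.+1 = i.+2 by lia.
have -> : maxn i.+1 j.+2 = i.+1 by lia.
have -> : maxn i.+2 j.+2 = i.+2 by lia.
by rewrite mulr0n andbT /=; case: ifP => _; ring.
Qed.

Lemma det_congr_difference (A : 'M[R]_n) : \det (L *m A *m L^T) = \det A.
Proof. by rewrite !det_mulmx det_tr det_difference_mx mul1r mulr1. Qed.

Lemma det_spline : \det K = \prod_i d 0 i.
Proof. by rewrite -det_congr_difference difference_spline det_diag. Qed.

Lemma det_spline_gt0 : alpha != 0 -> 0 < \det K.
Proof.
move=> alpha_neq0; rewrite det_spline; apply: prodr_gt0 => i _.
by rewrite spline_increments_gt0 // lt_neqAle eq_sym alpha_neq0.
Qed.

Lemma difference_mx_unit : L \in unitmx.
Proof. by rewrite unitmxE det_difference_mx unitr1. Qed.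

Lemma congr_difference_inj (A B : 'M[R]_n) :
  L *m A *m L^T = L *m B *m L^T -> A = B.
Proof.
have LU := difference_mx_unit; have LTU : L^T \in unitmx by rewrite unitmx_tr.
by move=> /(can_inj (mulmxK LTU)) /(can_inj (mulKmx LU)).
Qed.

(** Inverting [L] exhibits [K] as congruent to a nonnegative diagonal matrix. *)
Lemma psdmx_spline : psdmx K.
Proof.
have -> : K = invmx L *m diag_mx d *m (invmx L)^T.
  apply: congr_difference_inj; rewrite difference_spline !mulmxA.
  rewrite mulmxV ?difference_mx_unit // mul1mx -mulmxA -trmx_mul.
  by rewrite mulmxV ?difference_mx_unit // trmx1 mulmx1.
by apply: psdmx_congr; apply: psdmx_diag_mx; apply: spline_increments_ge0.
Qed.

(** Row [i] of [L] is supported on columns [i] and [i.+1], so this entry reads [A] only at pairs of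
    these indices, all inside the band. *)
Lemma diag_congr_difference (A : 'M[R]_n) i :
  (forall i j : 'I_n, (j - i <= 1)%N -> (i - j <= 1)%N -> A i j = K i j) ->
  (L *m A *m L^T) i i = d 0 i.
Proof.
move=> A_band; transitivity ((L *m K *m L^T) i i); last first.
  by rewrite difference_spline mxE eqxx mulr1n.
rewrite !mxE; apply: eq_bigr => l _; rewrite [L^T _ _]mxE.
have [-> | /difference_mx_neq0 il] := eqVneq (L i l) 0; first by rewrite !mulr0.
rewrite !mxE; congr (_ * _); apply: eq_bigr => k _.
have [-> | /difference_mx_neq0 ik] := eqVneq (L i k) 0; first by rewrite !mul0r.
by rewrite A_band //; lia.
Qed.

Lemma spline_rigidity (A : 'M[R]_n) :
  psdmx A ->
  (forall i j : 'I_n, (j - i <= 1)%N -> (i - j <= 1)%N -> A i j = K i j) ->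
  alpha = 0 \/ \det K <= \det A -> A = K.
Proof.
move=> A_psd A_band hyp; apply: congr_difference_inj.
have B_psd := psdmx_congr _ _ _ L _ A_psd.
have B_diag i := diag_congr_difference A i A_band.
suff /is_diag_mxP offdiag : is_diag_mx (L *m A *m L^T).
  rewrite difference_spline; apply/matrixP => i j; rewrite [RHS]mxE.
  have [<- | neq_ij] := eqVneq i j; first by rewrite B_diag.
  by rewrite offdiag.
have [alpha0 | alpha_neq0] := eqVneq alpha 0.
  apply/is_diag_mxP => i j _; apply: psdmx_diag_eq0 => //.
  by rewrite B_diag mxE alpha0 !expr0n /= if_same subr0.
have {hyp} detKA : \det K <= \det A.
  by case: hyp => // /eqP; rewrite (negPf alpha_neq0).
(* This turns [detKA] into the reverse of Hadamard's inequality for [L *m A *m L^T]. *)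
have detE : \prod_i (L *m A *m L^T) i i = \det K.
  by rewrite det_spline; apply: eq_bigr => i _; apply: B_diag.
apply: hadamard_rigidity; rewrite // ?detE det_congr_difference //.
exact: lt_le_trans (det_spline_gt0 alpha_neq0) detKA.
Qed.

End Kernel.

(** * Band extensions, and comparison of the objective through determinants *)

Lemma band_extension_band (m n : nat) (sigma : 'M[R]_n)
    (x : {ffun off_band m n -> R}) (i j : 'I_n) :
  (j - i <= m)%N -> (i - j <= m)%N -> band_extension sigma x i j = sigma i j.
Proof. by move=> ji ij; rewrite mxE !insubF //= ltnNge ?ij ?ji. Qed.

Lemma band_extension_off (m n : nat) (sigma : 'M[R]_n)
    (x : {ffun off_band m n -> R}) (p : off_band m n) :
  band_extension sigma x (val p).1 (val p).2 = x p.
Proof. by rewrite mxE -surjective_pairing valK. Qed.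

Lemma band_extension_restrict (m n : nat) (sigma : 'M[R]_n) :
  sigma^T = sigma ->
  band_extension sigma
    [ffun p : off_band m n => sigma (val p).1 (val p).2] = sigma.
Proof.
move=> sigmaT; apply/matrixP => i j; rewrite mxE.
case: insubP => [p _ Ep | _]; first by rewrite ffunE Ep.
by case: insubP => [p _ Ep | _] //; rewrite ffunE Ep /= -[in LHS]sigmaT mxE.
Qed.

(** All nonpositive determinants give the value [+oo], so the order of determinants is lost only
    when neither is positive, which the hypothesis excludes. *)
Lemma neg_logdet_le (n : nat) (A B : 'M[R]_n) : 0 < \det A \/ 0 < \det B ->
  (neg_logdet A <= neg_logdet B)%E = (\det B <= \det A).
Proof.
rewrite /neg_logdet leeN2 => det_gt0.
have [detB_le0 | detB_gt0] := leP (\det B) 0.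
  rewrite le0_lneNy ?lee_fin // leNye (le_trans detB_le0) //.
  by case: det_gt0 => [/ltW // | /lt_geF]; rewrite detB_le0.
have [detA_le0 | detA_gt0] := leP (\det A) 0.
  rewrite lne_EFin // le0_lneNy ?lee_fin // leeNy_eq /=.
  by rewrite leNgt (le_lt_trans detA_le0).
by rewrite !lne_EFin // lee_fin ler_ln ?posrE.
Qed.

End StableSpline.

Theorem proposition4p1 (R : realType) (n : nat) (alpha : R)
    (alpha_ge0 : 0 <= alpha) (alpha_lt1 : alpha < 1) :
  exists xo : {ffun off_band 1 n -> R},
    unique (max_entropy_solution (stable_spline_kernel n alpha)) xo /\
    band_extension (stable_spline_kernel n alpha) xo = stable_spline_kernel n alpha.
Proof.
set K := stable_spline_kernel n alpha.
have K_psd : psdmx K by apply: psdmx_spline.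
have KT : K^T = K by apply/symmetricmxP; case: K_psd.
(* The candidate optimum takes its free entries from the kernel itself. *)
have xoE := band_extension_restrict R 1 n K KT.
set xo := (X in band_extension K X) in xoE.
have rigid (y : {ffun off_band 1 n -> R}) : psdmx (band_extension K y) ->
    alpha = 0 \/ \det K <= \det (band_extension K y) -> band_extension K y = K.
  move=> y_psd; apply: spline_rigidity => // i j.
  exact: band_extension_band.
exists xo; split=> //; split.
  split=> [|y y_psd]; rewrite xoE //.
  have [alpha0 | alpha_neq0] := eqVneq alpha 0.
    by rewrite rigid //; left.
  rewrite neg_logdet_le; last by left; apply: det_spline_gt0.
  (* A feasible matrix of strictly larger determinant would equal [K] by [rigid], which contradicts
     the strictness. *)
  rewrite leNgt; apply/negP => lt_det.
  by move: (lt_det); rewrite rigid ?ltxx //; right; apply: ltW.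
move=> y [y_psd y_opt]; suff yE : band_extension K y = K.
  by apply/ffunP => p; rewrite -!(band_extension_off R 1 n K) xoE yE.
apply: rigid => //; have [|alpha_neq0] := eqVneq alpha 0; [by left | right].
(* Comparing the optimal [y] with the feasible point [xo] supplies the determinant bound that
   [rigid] asks for. *)
have := y_opt xo; rewrite xoE => /(_ K_psd); rewrite neg_logdet_le //.
by right; apply: det_spline_gt0.
Qed.
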